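(* Let $V$ be a finite set, let $A$ be a $V\times V$-matrix over $\mathbb{F}_2$, and let $X\subseteq V$. Then $\mathcal{M}_{A+X}=\mathcal{M}_A+X$.
   Context: A set system over a finite set $V$ is a pair $M=(V,D)$ with $D$ a family of subsets of $V$. For a $V\times V$-matrix $A$ over $\mathbb{F}_2$ and $X\subseteq V$, $A[X]$ is the principal submatrix with rows and columns in $X$ (with $\det A[\varnothing]=1$), and $\mathcal{M}_A=(V,D_A)$ with $D_A=\{X\subseteq V\mid \det A[X]\neq 0\}$. The matrix $A+X$ is obtained from $A$ by adding $1$ to each diagonal entry $a_{xx}$ with $x\in X$. Loop complementation on set systems: for $M=(V,D)$ and $j\in V$, $M+\{j\}=(V,D')$ where for all $Z\subseteq V$: if $j\in Z$, then $Z\in D'$ iff exactly one of $Z\in D$ and $Z\setminus\{j\}\in D$ holds; if $j\notin Z$, then $Z\in D'$ iff $Z\in D$. For $X=\{x_1,\dots,x_n\}\subseteq V$, $M+X$ denotes $(\cdots((M+\{x_1\})+\{x_2\})\cdots)+\{x_n\}$ (the result does not depend on the order), with $M+\varnothing=M$. *)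

(* Defs.v *)
From HB Require Import structures.
From mathcomp Require Import all_boot all_order all_algebra.

Set Implicit Arguments.
Unset Strict Implicit.
Unset Printing Implicit Defensive.

Import GRing.Theory.
Local Open Scope ring_scope.

(* A V x V matrix over F_2 is a 'M['F_2]_#|V|: the row and column of x : V     *)
(* are those of index enum_rank x. A set system over V is identified with its *)
(* family of sets D : {set {set V}}, the ground set being the type V.         *)

Definition principal_submx (V : finType) (A : 'M['F_2]_#|V|) (X : {set V}) :
    'M['F_2]_#|X| :=
  \matrix_(i < #|X|, j < #|X|)
     A (enum_rank (enum_val i)) (enum_rank (enum_val j)).

Definition mx_setsys (V : finType) (A : 'M['F_2]_#|V|) : {set {set V}} :=
  [set X : {set V} | \det (principal_submx A X) != 0].

Definition mx_loop (V : finType) (A : 'M['F_2]_#|V|) (X : {set V}) :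
    'M['F_2]_#|V| :=
  A + diag_mx (\row_(i < #|V|) (enum_val i \in X)%:R).

Definition loop1 (V : finType) (D : {set {set V}}) (j : V) : {set {set V}} :=
  [set Z : {set V} |
     if j \in Z then (Z \in D) (+) (Z :\ j \in D) else Z \in D].

(* The elements of X are processed in the order of enum X; any other          *)
(* duplicate-free enumeration gives the same result (setsys_loop_seq below).  *)
Definition setsys_loop (V : finType) (D : {set {set V}}) (X : {set V}) :
    {set {set V}} :=
  foldl (@loop1 V) D (enum X).

Lemma loop1C (V : finType) (D : {set {set V}}) (i j : V) :
  loop1 (loop1 D i) j = loop1 (loop1 D j) i.
Proof.
have [-> // | nij] := eqVneq i j.
apply/setP=> Z; rewrite !inE nij [j == i]eq_sym nij /=.
have -> : Z :\ i :\ j = Z :\ j :\ i by rewrite !setDDl setUC.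
by do 2!case: ifP => _ //; rewrite -!addbA; congr (_ (+) _); rewrite addbCA.
Qed.

Lemma setsys_loop_seq (V : finType) (D : {set {set V}}) (X : {set V})
    (s : seq V) :
  uniq s -> s =i X -> foldl (@loop1 V) D s = setsys_loop D X.
Proof.
move=> us sX.
have foldlC E t x : x \in t ->
    foldl (@loop1 V) E t = foldl (@loop1 V) (loop1 E x) (rem x t).
  elim: t E => //= y t IHt E; rewrite inE.
  by have [-> // | _ /= /IHt ->] := eqVneq y x; rewrite loop1C.
have: perm_eq s (enum X).
  by apply: uniq_perm; rewrite ?enum_uniq // => x; rewrite mem_enum sX.
rewrite /setsys_loop; elim: s (enum X) D {us sX} => [|x s IHs] t E.
  by move=> /perm_size/esym/size0nil->.
move=> st; have tx: x \in t by rewrite -(perm_mem st) mem_head.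
rewrite /= (foldlC E t x tx); apply: IHs.
by rewrite -(perm_cons x) (perm_trans st) // perm_to_rem.
Qed.

(* Main.v *)
(* Extending A[Z] by the identity outside Z does not change its determinant,  *)
(* by Sylvester's identity det (1 - UV) = det (1 - VU). For j in Z, row j of  *)
(* the matrix so obtained from A + {j} is the sum of the corresponding row    *)
(* for A and of the unit row e_j, and replacing row j by e_j amounts to       *)
(* removing j from Z, so det (A + {j})[Z] = det A[Z] + det A[Z \ j] by        *)
(* linearity in row j.                                                        *)
Require Import Defs.
From HB Require Import structures.
From mathcomp Require Import all_boot all_order all_algebra.

Set Implicit Arguments.
Unset Strict Implicit.
Unset Printing Implicit Defensive.

Import GRing.Theory.
Local Open Scope ring_scope.

(** Loops at distinct elements can be added one at a time, so induction along an enumeration of [X]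
    reduces the theorem to a singleton. There, [pad_submx] gives all principal minors the common
    size [#|V|], so that they can be compared by linearity in one row; over F_2 a sum is nonzero iff
    exactly one term is, which is the rule of [loop1]. *)

Lemma det_sub1_mulmxC (R : comNzRingType) (m n : nat)
    (U : 'M[R]_(m, n)) (W : 'M[R]_(n, m)) :
  \det (1%:M - U *m W) = \det (1%:M - W *m U).
Proof.
have /(congr1 determinant) :
    (* Both products equal the block matrix with rows [(1, U)] and [(W, 1)]. *)
    block_mx (1%:M - U *m W) U 0 1%:M *m block_mx 1%:M 0 W 1%:M =
    block_mx 1%:M 0 W 1%:M *m block_mx 1%:M U 0 (1%:M - W *m U).
  rewrite !mulmx_block !(mulmx0, mul0mx, mulmx1, mul1mx, addr0, add0r).
  by rewrite subrK addrC subrK.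
by rewrite !det_mulmx !det_ublock !det_lblock !det1 !(mulr1, mul1r).
Qed.

(** Rows in [X] keep their entries in columns outside [X], so that removing one element from [X]
    affects a single row. *)
Definition pad_submx (V : finType) (A : 'M['F_2]_#|V|) (X : {set V}) :
    'M['F_2]_#|V| :=
  \matrix_(i, j) if enum_val i \in X then A i j else (i == j)%:R.

Lemma det_pad_submx (V : finType) (A : 'M['F_2]_#|V|) (X : {set V}) :
  \det (pad_submx A X) = \det (principal_submx A X).
Proof.
pose f (k : 'I_#|X|) : 'I_#|V| := enum_rank (enum_val k).
have f_inj : injective f by move=> k l /enum_rank_inj/enum_val_inj.
(* [E] selects the coordinates in [X]: [E *m E^T] is the identity, [E^T *m E] the diagonal projector
   onto [X], and A[X] is [E *m A *m E^T]. *)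
pose E : 'M['F_2]_(#|X|, #|V|) := rowsub f 1%:M.
have EE : E *m E^T = 1%:M.
  rewrite mul_rowsub_mx mul1mx; apply/matrixP=> k l.
  by rewrite !mxE (inj_eq f_inj) eq_sym.
have -> : principal_submx A X = 1%:M - (E *m (1%:M - A)) *m E^T.
  rewrite mulmxBr mulmx1 mulmxBl EE subKr mul_rowsub_mx mul1mx.
  apply/matrixP=> k l; rewrite !mxE (bigD1 (f l)) //= !mxE eqxx mulr1 big1 ?addr0 //.
  by move=> i ne; rewrite !mxE eq_sym (negPf ne) mulr0.
rewrite -det_sub1_mulmxC mulmxA; congr (\det _).
have EtE i j : (E^T *m E) i j = ((enum_val i \in X) && (i == j))%:R.
  rewrite mxE; have [iX|iX] /= := boolP (enum_val i \in X).
    pose k := enum_rank_in iX (enum_val i).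
    have fk : f k = i by rewrite /f enum_rankK_in // enum_valK.
    rewrite (bigD1 k) //= !mxE fk eqxx mul1r big1 ?addr0 // => l ne.
    by rewrite !mxE -fk (inj_eq f_inj) (negPf ne) mul0r.
  rewrite big1 // => l _; rewrite !mxE; case: eqP => [fl|_]; last by rewrite mul0r.
  by rewrite -fl /f enum_rankK enum_valP in iX.
move: (E^T *m E) EtE => P PE; apply/matrixP=> i j; rewrite mulmxBr mulmx1 !mxE.
rewrite PE (bigD1 i) //= PE eqxx andbT big1 ?addr0; last first.
  by move=> l ne; rewrite PE eq_sym (negPf ne) andbF mul0r.
by case: ifP => _ /=; rewrite ?mul1r ?subKr ?mul0r ?subr0.
Qed.

Lemma mem_mx_setsys (V : finType) (A : 'M['F_2]_#|V|) (X : {set V}) :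
  (X \in mx_setsys A) = (\det (pad_submx A X) != 0).
Proof. by rewrite inE det_pad_submx. Qed.

Lemma mx_loopE (V : finType) (A : 'M['F_2]_#|V|) (X : {set V}) i j :
  mx_loop A X i j = A i j + ((enum_val i \in X) && (i == j))%:R.
Proof. by rewrite !mxE; case: (i == j); rewrite ?andbT ?andbF. Qed.

Lemma F2_add_neq0 (a b : 'F_2) : (a + b != 0) = (a != 0) (+) (b != 0).
Proof. by case: a b => [[|[|?]] ?] [[|[|?]] ?]. Qed.

Lemma mx_setsys_loop1 (V : finType) (A : 'M['F_2]_#|V|) (x : V) :
  mx_setsys (mx_loop A [set x]) = loop1 (mx_setsys A) x.
Proof.
apply/setP=> Z; rewrite [RHS]inE !mem_mx_setsys.
(* If [x] is outside [Z], the changed entry lies in a row that the padding overwrites. *)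
case: ifPn => xZ; last first.
  congr (\det _ != 0); apply/matrixP=> i j; rewrite mxE [RHS]mxE mx_loopE inE.
  case: ifP => // iZ; have [eix|_] := eqVneq; last by rewrite addr0.
  by rewrite -eix iZ in xZ.
rewrite -F2_add_neq0; congr (_ != 0).
rewrite (@determinant_multilinear _ _ _ (pad_submx A Z)
          (pad_submx A (Z :\ x)) (enum_rank x) 1 1) ?mul1r //.
- apply/rowP=> j; rewrite !scale1r !mxE !enum_rankK !inE eqxx xZ /=.
  by case: (_ == j); rewrite ?mul0rn.
- apply/matrixP=> i j; rewrite !mxE; case: ifP => // _.
  rewrite in_set1 (can2_eq (@enum_valK _) (@enum_rankK _)) eq_sym.
  by rewrite (negPf (neq_lift _ _)) mul0rn addr0.
- apply/matrixP=> i j; rewrite !mxE in_setD1.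
  rewrite (can2_eq (@enum_valK _) (@enum_rankK _)) [X in ~~ X]eq_sym.
  rewrite (negPf (neq_lift _ _)) /=; case: ifP => // _.
  rewrite in_set1 (can2_eq (@enum_valK _) (@enum_rankK _)) eq_sym.
  by rewrite (negPf (neq_lift _ _)) mul0rn addr0.
Qed.

Lemma mx_loopU1 (V : finType) (A : 'M['F_2]_#|V|) (x : V) (X : {set V}) :
  x \notin X -> mx_loop (mx_loop A [set x]) X = mx_loop A (x |: X).
Proof.
move=> xX; apply/matrixP=> i j; rewrite !mx_loopE -addrA !inE; congr (_ + _).
by have [->|_] := eqVneq; rewrite ?(negPf xX) ?addr0 ?add0r.
Qed.

(** The induction lets [A] vary, since the head of [s] is absorbed into the matrix; by [uniq] no
    diagonal entry receives 1 twice. *)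
Lemma mx_setsys_loop_seq (V : finType) (A : 'M['F_2]_#|V|) (s : seq V) :
  uniq s -> mx_setsys (mx_loop A [set:: s]) = foldl (@loop1 V) (mx_setsys A) s.
Proof.
elim: s A => [|x s IHs] A /=.
  by move=> _; congr mx_setsys; apply/matrixP=> i j; rewrite mx_loopE inE addr0.
by case/andP=> xs us; rewrite -mx_setsys_loop1 -IHs // mx_loopU1 ?set_cons ?inE.
Qed.

Theorem theorem8 (V : finType) (A : 'M['F_2]_#|V|) (X : {set V}) :
  mx_setsys (mx_loop A X) = setsys_loop (mx_setsys A) X.
Proof.
by rewrite /setsys_loop -mx_setsys_loop_seq ?enum_uniq // set_enum.
Qed.
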